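(* There is an absolute constant $C_0>0$ such that the following holds. Let $0<\mu\le L$, $\kappa=L/\mu$, $f\in S_{\mu,L}(\mathbb{R}^d)$, $p\ge1$. Run the algorithm M-ASG with $\alpha_1=\frac1L$, $n_1=\left\lceil(p+1)\sqrt{\kappa}\log\big(12(p+1)\kappa\big)\right\rceil$ and, for $k\ge2$, $n_k=2^k\lceil\sqrt{\kappa}\log(2^{p+2})\rceil$ and $\alpha_k=\frac{1}{2^{2k}L}$. Then for every integer $n\ge2n_1$, $$\mathbb{E}[f(x_n)]-f^*\le C_0\left(\frac{1}{n^{p+1}}\big(f(x_0^0)-f^*\big)+\frac{(p+1)\sigma^2}{n\mu}\right),$$ where $x_n$ denotes the iterate of M-ASG after $n$ gradient steps.
   Context: $S_{\mu,L}(\mathbb{R}^d)$ is the set of continuously differentiable $f:\mathbb{R}^d\to\mathbb{R}$ with $\frac{\mu}{2}\|x-y\|^2\le f(x)-f(y)-\nabla f(y)^\top(x-y)\le\frac L2\|x-y\|^2$ for all $x,y$. $x^*$ is the unique minimizer of $f$, $f^*=f(x^* )$; $\log$ is the natural logarithm. Stochastic oracle with noise level $\sigma\ge0$: each time the algorithm needs a gradient at a query point $z$ (a function of the initial point and of the randomness used in earlier queries), it receives $\tilde\nabla f(z,w)$, where the random variables $w$ used in the different queries are independent, so that $w$ is independent of all the past, and $\mathbb{E}[\tilde\nabla f(z,w)\mid z]=\nabla f(z)$, $\mathbb{E}[\|\tilde\nabla f(z,w)-\nabla f(z)\|^2\mid z]\le\sigma^2$. M-ASG (Multistage Accelerated Stochastic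 Gradient) with stage lengths $n_k\in\mathbb{N}$ and stepsizes $\alpha_k\in(0,1/L]$, from a deterministic initial point $x_0^0\in\mathbb{R}^d$: for stages $k=1,2,\dots$, let $\beta_k=\frac{1-\sqrt{\mu\alpha_k}}{1+\sqrt{\mu\alpha_k}}$; set $x_0^k=x_1^k=x_{n_{k-1}+1}^{k-1}$ (for $k=1$: $x_0^1=x_1^1=x_0^0$); and for $m=1,\dots,n_k$ set $y_m^k=(1+\beta_k)x_m^k-\beta_k x_{m-1}^k$ and $x_{m+1}^k=y_m^k-\alpha_k\tilde\nabla f(y_m^k,w_m^k)$. Iterate after $n$ gradient steps: $x_0=x_0^0$, $x_n=x^1_{n+1}$ for $1\le n\le n_1$, and for $n>n_1$, $x_n=x^k_{m+1}$, where $k\ge2$ is the stage with $N_{k-1}<n\le N_k$, $N_k=\sum_{i=1}^k n_i$, and $m=n-N_{k-1}$. *)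

(* Defs.v *)
From HB Require Import structures.
From mathcomp Require Import all_boot all_order all_algebra.
From mathcomp Require Import finmap.
From mathcomp Require Import all_classical all_reals all_analysis.

Set Implicit Arguments.
Unset Strict Implicit.
Unset Printing Implicit Defensive.

Import Order.TTheory GRing.Theory Num.Theory.
Import numFieldNormedType.Exports.

Local Open Scope classical_set_scope.
Local Open Scope ring_scope.

Section euclidean_space.
Context {R : realType} {d : nat}.
Implicit Types (x y : 'rV[R]_d) (f : 'rV[R]_d -> R).

Definition dotp x y : R := \sum_i x 0 i * y 0 i.

(* The library norm `|x| on 'rV[R]_d is the sup norm; its topology, hence its
   open sets and differentiability, are the Euclidean ones. *)
Definition enorm x : R := Num.sqrt (dotp x x).

(* Meaningful only where f is differentiable. *)
Definition grad f x : 'rV[R]_d := \row_i 'D_(delta_mx 0 i) f x.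

Definition smooth_strongly_convex (mu L : R) f : Prop :=
  [/\ forall x, differentiable f x,
      continuous (grad f) &
      forall x y,
        mu / 2 * enorm (x - y) ^+ 2 <= f x - f y - dotp (grad f y) (x - y) /\
        f x - f y - dotp (grad f y) (x - y) <= L / 2 * enorm (x - y) ^+ 2].

End euclidean_space.

Definition borel_rV (R : realType) (d : nat) :=
  g_sigma_algebraType (@open 'rV[R]_d).

Section probability.
Context {R : realType} {dT : measure_display} {T : measurableType dT}.
Variable P : probability T R.

Definition sigma_of {dU} {U : measurableType dU} (Z : T -> U) : set_system T :=
  preimage_set_system setT Z measurable.

(* C is a version of the conditional expectation of X given the
   sub-sigma-algebra F. *)
Definition is_cond_expectation (F : set_system T) (X C : T -> R) : Prop :=
  [/\ P.-integrable setT (EFin \o X),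
      P.-integrable setT (EFin \o C),
      forall B : set R, measurable B -> F (C @^-1` B) &
      forall A, F A -> (\int[P]_(t in A) (X t)%:E = \int[P]_(t in A) (C t)%:E)%E].

Definition mutually_independent {dW} {W : measurableType dW} {I : choiceType}
    (J : set I) (X : I -> {RV P >-> W}) : Prop :=
  forall (s : {fset I}) (A : I -> set W),
    [set` s] `<=` J ->
    (forall i, i \in s -> measurable (A i)) ->
    P (\bigcap_(i in [set` s]) (X i @^-1` A i)) =
    (\prod_(i <- s) P (X i @^-1` A i))%E.

(* Oracle answer G (z, w) at the random query point z: E[G(z,w) | z] = grad f z
   coordinatewise, and E[|G(z,w) - grad f z|^2 | z] <= sigma^2 almost surely. *)
Definition unbiased_bounded_variance {d} {dW} {W : measurableType dW}
    (f : 'rV[R]_d -> R) (sigma : R) (G : borel_rV R d * W -> borel_rV R d)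
    (z : T -> borel_rV R d) (w : T -> W) : Prop :=
  (forall i : 'I_d,
    is_cond_expectation (sigma_of z)
      (fun t => (G (z t, w t) : 'rV[R]_d) 0 i) (fun t => grad f (z t) 0 i)) /\
  exists2 V : T -> R,
    is_cond_expectation (sigma_of z)
      (fun t => enorm ((G (z t, w t) : 'rV[R]_d) - grad f (z t)) ^+ 2) V &
    {ae P, forall t, V t <= sigma ^+ 2}.

End probability.

Section M_ASG.
Context {R : realType} {d : nat}.
Variables (mu : R) (alpha : nat -> R) (len : nat -> nat).
(* g k m z is the (sampled) gradient returned by query m of stage k at z. *)
Variables (g : nat -> nat -> 'rV[R]_d -> 'rV[R]_d) (x00 : 'rV[R]_d).

Definition momentum (a : R) : R :=
  (1 - Num.sqrt (mu * a)) / (1 + Num.sqrt (mu * a)).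

(* One stage started from x_0 = x_1 = x0: the value at m.+1 is
   y_m - a * gk m y_m with y_m = (1 + b) x_m - b x_(m-1). *)
Fixpoint asg_stage (a b : R) (gk : nat -> 'rV[R]_d -> 'rV[R]_d)
    (x0 : 'rV[R]_d) (m : nat) : 'rV[R]_d :=
  match m with
  | 0 => x0
  | m1.+1 =>
    match m1 with
    | 0 => x0
    | m2.+1 =>
      let y := (1 + b) *: asg_stage a b gk x0 m1 - b *: asg_stage a b gk x0 m2 in
      y - a *: gk m1 y
    end
  end.

(* Stages are numbered from 1; the value at 0 is a dummy. *)
Fixpoint masg_start (k : nat) : 'rV[R]_d :=
  match k with
  | 0 => x00
  | k1.+1 =>
    match k1 with
    | 0 => x00
    | _.+1 => asg_stage (alpha k1) (momentum (alpha k1)) (g k1)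
                (masg_start k1) (len k1).+1
    end
  end.

Definition masg_x (k m : nat) : 'rV[R]_d :=
  asg_stage (alpha k) (momentum (alpha k)) (g k) (masg_start k) m.

Definition masg_y (k m : nat) : 'rV[R]_d :=
  (1 + momentum (alpha k)) *: masg_x k m - momentum (alpha k) *: masg_x k m.-1.

Definition stage_end (k : nat) : nat := \sum_(1 <= i < k.+1) len i.

(* The least k with n <= stage_end k; the search up to n suffices when all
   stage lengths are positive, see stage_ofP. *)
Definition stage_of (n : nat) : nat :=
  find (fun k => n <= stage_end k)%N (iota 0 n.+1).

Definition masg_iterate (n : nat) : 'rV[R]_d :=
  if n == 0%N then x00
  else masg_x (stage_of n) (n - stage_end (stage_of n).-1).+1.

Lemma stage_ofP (n : nat) :
  (forall k, 0 < k -> 0 < len k)%N -> (0 < n)%N ->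
  (0 < stage_of n)%N /\
  (stage_end (stage_of n).-1 < n <= stage_end (stage_of n))%N.
Proof.
move=> len_gt0 n_gt0.
have le_end k : (k <= stage_end k)%N.
  elim: k => // k IH; rewrite /stage_end big_nat_recr //=.
  by rewrite -[leqLHS]addn1 leq_add // len_gt0.
have has_n : has (fun k => n <= stage_end k)%N (iota 0 n.+1).
  by apply/hasP; exists n; rewrite ?mem_iota ?le_end //= add0n ltnS leqnn.
have := has_n; rewrite has_find size_iota => lt_n.
have := nth_find 0%N has_n; rewrite nth_iota // add0n -/(stage_of n) => len_n.
have sn_gt0 : (0 < stage_of n)%N.
  case: (stage_of n) len_n => // ; rewrite /stage_end big_geq // leqn0 => /eqP n0.
  by rewrite n0 in n_gt0.
split=> //; rewrite len_n andbT ltnNge.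
have lt_pred : ((stage_of n).-1 < stage_of n)%N by rewrite prednK.
have := before_find 0%N lt_pred.
by rewrite nth_iota ?add0n 1?(ltn_trans lt_pred) // => ->.
Qed.

Lemma masg_xE (k m : nat) : (0 < m)%N ->
  masg_x k m.+1 = masg_y k m - alpha k *: g k m (masg_y k m).
Proof. by case: m. Qed.

End M_ASG.

(* Main.v *)
(* With q = sqrt(mu a), one step of a stage contracts the Lyapunov function
   V(x, x') = f x - f* + (mu/2) |v - x*|^2, v = x' + (x - x') / q, by the factor
   1 - q, up to a |e|^2 plus a term linear in the gradient noise e whose weight is
   determined by the past.  The oracle is only assumed unbiased conditionally on
   the query point; independence of the samples upgrades this to unbiasedness
   conditionally on the whole past (by Fubini, the mean of G(z, w) - grad f z over
   w vanishes for almost every query point z), so the linear term has mean zero.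
   A stage of m steps thus turns the gap d into at most
   2 (1 - q)^m d + sigma^2 q / mu, since V(x, x) <= 2 (f x - f* ).  The stage
   lengths make stage 1 contract by (12 (p+1) kappa)^-(p+1) and each later one by
   2^-(p+1), while q halves; finally n >= 2 n_1 puts n in a stage k >= 2 and bounds
   it by 12 2^(k-2) sqrt(kappa) (p + 1 + 7/3). *)

Require Import Defs.
From HB Require Import structures.
From mathcomp Require Import all_boot all_order all_algebra.
From mathcomp Require Import finmap.
From mathcomp Require Import all_classical all_reals all_analysis.
From mathcomp Require Import measurable_realfun.
From mathcomp Require Import ring lra.

Set Implicit Arguments.
Unset Strict Implicit.
Unset Printing Implicit Defensive.

Import Order.TTheory GRing.Theory Num.Theory.
Import numFieldNormedType.Exports.

Local Open Scope classical_set_scope.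
Local Open Scope ring_scope.

(** * Deterministic analysis of one accelerated step *)

Section dot_product.
Context {R : realType} {d : nat}.
Implicit Types (x y z : 'rV[R]_d) (a : R).

Lemma dotpC x y : dotp x y = dotp y x.
Proof. by apply: eq_bigr => i _; rewrite mulrC. Qed.

Lemma dotpDl x y z : dotp (x + y) z = dotp x z + dotp y z.
Proof. by rewrite -big_split; apply: eq_bigr => i _; rewrite mxE mulrDl. Qed.

Lemma dotpZl a x z : dotp (a *: x) z = a * dotp x z.
Proof. by rewrite /dotp mulr_sumr; apply: eq_bigr => i _; rewrite mxE mulrA. Qed.

Lemma dotpNl x z : dotp (- x) z = - dotp x z.
Proof. by rewrite -scaleN1r dotpZl mulN1r. Qed.

Lemma dotp0l z : dotp 0 z = 0.
Proof. by rewrite -(scale0r 0) dotpZl mul0r. Qed.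

Lemma dotpDr x y z : dotp z (x + y) = dotp z x + dotp z y.
Proof. by rewrite dotpC dotpDl !(dotpC z). Qed.

Lemma dotpZr a x z : dotp z (a *: x) = a * dotp z x.
Proof. by rewrite dotpC dotpZl (dotpC z). Qed.

Lemma dotpNr x z : dotp z (- x) = - dotp z x.
Proof. by rewrite dotpC dotpNl (dotpC z). Qed.

Definition dotpE := (dotpDl, dotpDr, dotpZl, dotpZr, dotpNl, dotpNr).

Lemma dotp_ge0 x : 0 <= dotp x x.
Proof. by apply: sumr_ge0 => i _; rewrite -expr2 sqr_ge0. Qed.

Lemma enorm_sqr x : enorm x ^+ 2 = dotp x x.
Proof. by rewrite sqr_sqrtr // dotp_ge0. Qed.

Lemma dotp_eq0 x : (dotp x x == 0) = (x == 0).
Proof.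
apply/eqP/eqP => [|->]; last by rewrite /dotp big1 // => i _; rewrite mxE mul0r.
move/eqP; rewrite psumr_eq0 => [/allP x0|i _]; last by rewrite -expr2 sqr_ge0.
apply/rowP => i; rewrite mxE; apply/eqP.
by have := x0 i (mem_index_enum i); rewrite /= mulf_eq0 orbb.
Qed.

Lemma sqr_coord_le x i : x 0 i ^+ 2 <= dotp x x.
Proof.
rewrite /dotp (bigD1 i) //= expr2 lerDl.
by apply: sumr_ge0 => j _; rewrite -expr2 sqr_ge0.
Qed.

End dot_product.

Section smooth_strongly_convex_minimum.
Context {R : realType} {d : nat}.
Variables (mu L : R) (f : 'rV[R]_d -> R) (xs : 'rV[R]_d).
Hypotheses (mu0 : 0 < mu) (muL : mu <= L).
Hypothesis ssc : smooth_strongly_convex mu L f.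
Hypothesis xs_min : forall y, f xs <= f y.

Let L0 : 0 < L. Proof. exact: lt_le_trans muL. Qed.

Lemma strong_convexity_ge x y :
  f y + dotp (grad f y) (x - y) + mu / 2 * dotp (x - y) (x - y) <= f x.
Proof. by case: ssc => _ _ /(_ x y) []; rewrite enorm_sqr; lra. Qed.

Lemma smoothness_le x y :
  f x <= f y + dotp (grad f y) (x - y) + L / 2 * dotp (x - y) (x - y).
Proof. by case: ssc => _ _ /(_ x y) []; rewrite enorm_sqr; lra. Qed.

(* One gradient step of length 1/L decreases f by at least |grad f|^2 / 2L. *)
Lemma sqr_grad_le y : dotp (grad f y) (grad f y) <= 2 * L * (f y - f xs).
Proof.
have := smoothness_le (y - L^-1 *: grad f y) y.
have := xs_min (y - L^-1 *: grad f y).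
rewrite [_ - y]addrC addKr !dotpE.
move: (f (y - _)) (dotp _ _) => fz h le1 le2.
have : f xs - f y <= - (L^-1 / 2 * h).
  have -> : - (L^-1 / 2 * h) = - (L^-1 * h) + L / 2 * - (L^-1 * - (L^-1 * h)).
    by field; rewrite gt_eqF.
  by lra.
rewrite -(@ler_pM2l _ (2 * L)) ?mulr_gt0 //.
have -> : 2 * L * - (L^-1 / 2 * h) = - h by field; rewrite gt_eqF.
by lra.
Qed.

(** At [y = xs] the right-hand side of [sqr_grad_le] vanishes. *)
Lemma grad_min_eq0 : grad f xs = 0.
Proof.
apply/eqP; rewrite -dotp_eq0 eq_le dotp_ge0 andbT.
by have := sqr_grad_le xs; rewrite subrr mulr0.
Qed.

Lemma subopt_ge0 x : 0 <= f x - f xs.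
Proof. by rewrite subr_ge0. Qed.

Lemma subopt_ge x : mu / 2 * dotp (x - xs) (x - xs) <= f x - f xs.
Proof.
have := strong_convexity_ge x xs.
by rewrite grad_min_eq0 dotp0l; lra.
Qed.

Lemma subopt_le x : f x - f xs <= L / 2 * dotp (x - xs) (x - xs).
Proof.
have := smoothness_le x xs.
by rewrite grad_min_eq0 dotp0l; lra.
Qed.

End smooth_strongly_convex_minimum.

Section accelerated_step.
Context {R : realType} {d : nat}.
Variables (mu L a : R) (f : 'rV[R]_d -> R) (xs : 'rV[R]_d).
Hypotheses (mu0 : 0 < mu) (muL : mu <= L) (a0 : 0 < a) (aL : a * L <= 1).
Hypothesis ssc : smooth_strongly_convex mu L f.
Hypothesis xs_min : forall y, f xs <= f y.

Let q := Num.sqrt (mu * a).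

Lemma rate_gt0 : 0 < q.
Proof. by rewrite sqrtr_gt0 mulr_gt0. Qed.

Lemma rate_le1 : q <= 1.
Proof.
rewrite -[leRHS]sqrtr1 ler_sqrt //; apply: le_trans aL.
by rewrite mulrC ler_pM2l.
Qed.

Lemma rate_sqr : q ^+ 2 = mu * a.
Proof. by rewrite sqr_sqrtr // mulr_ge0 // ltW. Qed.

(* The paper's quadratic term (1/2a) |(x - xs) - (1 - q) (x' - xs)|^2, rewritten
   through the auxiliary point v = x' + (x - x') / q of estimate sequences. *)
Definition mirror (x x' : 'rV[R]_d) := x' + q^-1 *: (x - x').

Definition lyapunov (x x' : 'rV[R]_d) :=
  f x - f xs + mu / 2 * dotp (mirror x x' - xs) (mirror x x' - xs).

Definition extrapolate (x x' : 'rV[R]_d) :=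
  (1 + momentum mu a) *: x - momentum mu a *: x'.

(** The coefficient of [e] when the Lyapunov function after the step is expanded: the term
    [- a *: grad f y] from smoothness cancels against [+ a *: grad f y] from the mirror term. *)
Definition noise_weight (x y : 'rV[R]_d) :=
  (L * a ^+ 2) *: grad f y - q *: (y - xs) - (1 - q) *: (y - x).

Lemma lyapunov_step (x x' y e : 'rV[R]_d) :
  y = extrapolate x x' ->
  lyapunov (y - a *: (grad f y + e)) x <=
  (1 - q) * lyapunov x x' + a * dotp e e + dotp (noise_weight x y) e.
Proof.
move=> yE; rewrite /lyapunov /noise_weight.
have q0 := rate_gt0; have q1 := rate_le1; have q2 := rate_sqr.
have qn0 : q != 0 by rewrite gt_eqF.
have q1n0 : 1 + q != 0 by rewrite gt_eqF // ltr_pwDl // ltW.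
pose D := mirror x x' - y; pose Y := y - xs.
(* The momentum coefficient is exactly the one for which [y] is the average of [x] and the mirror
   point with weights proportional to 1 and [q]. *)
have yx : y - x = q *: D.
  by apply/rowP => i; rewrite /D /mirror yE /extrapolate /momentum -/q !mxE; field; apply/andP.
set h := grad f y.
have vxs : mirror x x' - xs = Y + D by rewrite /D /Y [RHS]addrC addrA subrK.
have xy : x - y = - (q *: D) by rewrite -yx opprB.
(* The mirror point performs its own gradient step of length [q / mu], from the average of the old
   mirror point and [y] with weights [1 - q] and [q]. *)
have vxs' : mirror (y - a *: (h + e)) x - xs = Y + (1 - q) *: D - (q / mu) *: (h + e).
  have -> : q / mu = q^-1 * a.
    apply: (mulfI qn0); rewrite mulrA -expr2 q2 mulrA divff // mul1r.
    by field; rewrite gt_eqF.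
  have -> : Y = y - xs by [].
  have xE : x = y - q *: D by rewrite -yx opprB addrC subrK.
  move: D xE {vxs yx xy Y} => D ->.
  by apply/rowP => i; rewrite /mirror !mxE; field.
have up := smoothness_le ssc (y - a *: (h + e)) y.
have lo1 := strong_convexity_ge ssc x y.
have lo2 := strong_convexity_ge ssc xs y.
rewrite [_ - y]addrC addKr -/h in up.
rewrite -/h xy in lo1.
rewrite -/h -opprB -/Y in lo2.
rewrite vxs vxs' yx -/Y.
move: (f (y - _)) up => fz up.
clear vxs vxs' xy yx.
move: D Y h up lo1 lo2 => D Y h up lo1 lo2.
have DD0 := dotp_ge0 D; have hh0 := dotp_ge0 h; have ee0 := dotp_ge0 e.
rewrite !dotpE in up lo1 lo2 *.
rewrite (dotpC D Y) (dotpC h Y) (dotpC h D) (dotpC e h) (dotpC e Y) (dotpC e D).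
rewrite (dotpC h Y) in lo2; rewrite (dotpC h D) in lo1; rewrite (dotpC e h) in up.
move: (f x) (f y) (f xs) up lo1 lo2 => fx fy fs up lo1 lo2.
move: (dotp D D) (dotp h h) (dotp e e) DD0 hh0 ee0 up lo1 lo2 => DD hh ee DD0 hh0 ee0.
move: (dotp Y Y) (dotp Y D) (dotp Y h) (dotp Y e) (dotp D h) (dotp D e) (dotp h e).
move=> YY YD Yh Ye Dh De he up lo1 lo2.
have mu_n0 : mu != 0 by rewrite gt_eqF.
have -> : a = q ^+ 2 / mu by rewrite q2; field.
have := aL; rewrite (_ : a = q ^+ 2 / mu) in up *; last by rewrite q2; field.
move=> aL'.
(* The slack of the claim is exactly [p1 + p2 + p3 + p4] plus the slack of smoothness. Strong
   convexity is used towards [x] with weight [1 - q] and towards [xs] with weight [q]; [p3] collects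
   the leftover in [DD], and [p4], where [a * L <= 1] enters, those in [hh] and [ee]. *)
have p1 : 0 <= (1 - q) * (fx - (fy - q * Dh + mu / 2 * - (q * - (q * DD)))).
  by rewrite mulr_ge0 ?subr_ge0.
have p2 : 0 <= q * (fs - (fy - Yh + mu / 2 * - - YY)).
  by rewrite mulr_ge0 ?subr_ge0 // ltW.
have p3 : 0 <= (1 - q) * q * (1 + q) * mu / 2 * DD.
  by rewrite !mulr_ge0 ?subr_ge0 ?addr_ge0 ?invr_ge0 // ltW.
have p4 : 0 <= q ^+ 2 / (2 * mu) * (1 - q ^+ 2 / mu * L) * (hh + ee).
  rewrite !mulr_ge0 ?subr_ge0 ?addr_ge0 ?invr_ge0 ?mulr_ge0 // ltW //.
have up0 := up; rewrite -subr_ge0 in up0.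
rewrite -subr_ge0.
have := addr_ge0 (addr_ge0 p1 p2) (addr_ge0 (addr_ge0 p3 p4) up0).
by move=> /le_trans; apply; rewrite le_eqVlt; apply/orP; left; apply/eqP; field.
Qed.


Lemma subopt_le_lyapunov (x x' : 'rV[R]_d) : f x - f xs <= lyapunov x x'.
Proof. by rewrite lerDl mulr_ge0 ?dotp_ge0 // divr_ge0 // ltW. Qed.

Lemma lyapunov_start (x : 'rV[R]_d) : lyapunov x x <= 2 * (f x - f xs).
Proof.
rewrite /lyapunov /mirror subrr scaler0 addr0.
by have := subopt_ge mu0 muL ssc xs_min x; lra.
Qed.

End accelerated_step.

(** * Borel sets of row vectors *)

Section borel_row_vectors.
Context {R : realType} {d : nat}.

Lemma measurable_coord (i : 'I_d) :
  measurable_fun setT (fun v : borel_rV R d => (v : 'rV[R]_d) 0 i).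
Proof.
apply: (measurability _ (RGenOpens.measurableE R)).
move=> _ [_ [a [b ->] <-]]; rewrite setTI; apply: sub_sigma_algebra.
by apply: open_comp => [v _|]; [exact: coord_continuous|exact: interval_open].
Qed.

Lemma measurable_continuous_real (g : 'rV[R]_d -> R) :
  continuous g -> measurable_fun setT (g : borel_rV R d -> R).
Proof.
move=> cg; apply: (measurability _ (RGenOpens.measurableE R)).
move=> _ [_ [a [b ->] <-]]; rewrite setTI; apply: sub_sigma_algebra.
by apply: open_comp => [v _|]; [exact: cg|exact: interval_open].
Qed.

Lemma measurable_continuous_rV (g : 'rV[R]_d -> 'rV[R]_d) :
  continuous g -> measurable_fun setT (g : borel_rV R d -> borel_rV R d).
Proof.
move=> cg; apply: (@measurability _ _ _ (borel_rV R d) _ _ (@open 'rV[R]_d)) => //.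
move=> _ [U oU <-]; rewrite setTI; apply: sub_sigma_algebra.
by apply: open_comp => // v _; exact: cg.
Qed.

(** Sup-norm balls are boxes and the rationals are dense. The index set is countable, which lets
    measurability be tested coordinatewise. *)
Lemma open_rat_boxes (U : set 'rV[R]_d) : open U ->
  U = \bigcup_(ab in [set ab : 'rV[rat]_d * 'rV[rat]_d |
        [set v : 'rV[R]_d | forall i, ratr (ab.1 0 i) < v 0 i < ratr (ab.2 0 i)] `<=` U])
      [set v | forall i, ratr (ab.1 0 i) < v 0 i < ratr (ab.2 0 i)].
Proof.
move=> oU; apply/seteqP; split=> [v Uv|v [ab abU vab]]; last exact: abU.
have /nbhs_ballP[e /= e0 veU] : nbhs v U by exact: open_nbhs_nbhs.
have lt1 i : v 0 i - e < v 0 i by rewrite ltrBlDr ltrDl.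
have lt2 i : v 0 i < v 0 i + e by rewrite ltrDl.
pose a i := cid (rat_in_itvoo (lt1 i)).
pose b i := cid (rat_in_itvoo (lt2 i)).
have aP i : v 0 i - e < ratr (sval (a i)) < v 0 i by have := svalP (a i); rewrite in_itv.
have bP i : v 0 i < ratr (sval (b i)) < v 0 i + e by have := svalP (b i); rewrite in_itv.
exists (\row_i sval (a i), \row_i sval (b i)) => /=.
- move=> u uab; apply: veU; split=> // i j; rewrite ord1.
  have := uab j; rewrite !mxE => /andP[au ub].
  have /andP[av _] := aP j; have /andP[_ bv] := bP j.
  by rewrite /ball /= distrC ltr_distl (lt_trans av) //= (lt_trans ub).
- by move=> i; rewrite !mxE; have /andP[_ ->] := aP i; have /andP[-> _] := bP i.
Qed.

Lemma measurable_rowP {dT} {T : measurableType dT} (X : T -> 'rV[R]_d) :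
  (forall i, measurable_fun setT (fun t => X t 0 i)) <->
  measurable_fun setT (X : T -> borel_rV R d).
Proof.
split=> [mX|mX i]; last first.
  exact: (measurableT_comp (measurable_coord i) mX).
apply: (@measurability _ _ _ (borel_rV R d) _ _ (@open 'rV[R]_d)) => //.
move=> _ [U oU <-]; rewrite setTI (open_rat_boxes oU) preimage_bigcup.
rewrite bigcup_mkcond; apply: countable_bigcupT_measurable => // ab.
case: ifP => _ //.
have -> : X @^-1` [set v | forall i, ratr (ab.1 0 i) < v 0 i < ratr (ab.2 0 i)] =
    \bigcap_(i in [set: 'I_d]) (fun t => X t 0 i) @^-1` `]ratr (ab.1 0 i), ratr (ab.2 0 i)[%classic.
  apply/seteqP; split=> t /= H i => [_|]; first by rewrite /= in_itv /=.
  by have := H i I; rewrite /= in_itv.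
apply: fin_bigcap_measurable => // i _.
by rewrite -[X in measurable X]setTI; apply: mX.
Qed.

Lemma measurable_rV_lin {dT} {T : measurableType dT} (a b : R) (X Y : T -> 'rV[R]_d) :
  measurable_fun setT (X : T -> borel_rV R d) ->
  measurable_fun setT (Y : T -> borel_rV R d) ->
  measurable_fun setT ((fun t => a *: X t + b *: Y t) : T -> borel_rV R d).
Proof.
move=> /measurable_rowP mX /measurable_rowP mY; apply/measurable_rowP => i.
have -> : (fun t => (a *: X t + b *: Y t) 0 i) = (fun t => a * X t 0 i + b * Y t 0 i).
  by apply/funext => t; rewrite !mxE.
by apply: measurable_funD; apply: measurable_funM.
Qed.

End borel_row_vectors.

(** * Independence and Fubini *)

Section independence.
Context {R : realType} {dT} {T : measurableType dT} (P : probability T R).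

Definition mkRV {dS} {S : measurableType dS} (X : T -> S)
  (mX : measurable_fun setT X) : {RV P >-> S} :=
  MeasurableFun.Pack (MeasurableFun.Class (isMeasurableFun.Build _ _ _ _ _ mX)).

Definition independent2 {dS dW} {S : measurableType dS} {W : measurableType dW}
    (X : T -> S) (w : T -> W) :=
  forall A B, measurable A -> measurable B ->
    P (X @^-1` A `&` w @^-1` B) = (P (X @^-1` A) * P (w @^-1` B))%E.

Section joint_law.
Context {dS dW} {S : measurableType dS} {W : measurableType dW}.
Variables (X : {RV P >-> S}) (w : {RV P >-> W}).
Hypothesis indep : independent2 X w.

Let Xw : {RV P >-> (S * W)%type} :=
  mkRV (measurable_fun_pair (measurable_funPT X) (measurable_funPT w)).

(** Independence is the agreement of the two measures on rectangles, and the product measure is the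
    only one with these values. *)
Lemma joint_lawE (A : set (S * W)) : measurable A ->
  (distribution P X \x distribution P w)%E A = distribution P Xw A.
Proof.
by move=> mA; apply: (product_measure_unique (m' := distribution P Xw)).
Qed.

Lemma integrable_joint_law (F : S * W -> \bar R) : measurable_fun setT F ->
  P.-integrable setT (fun t => F (X t, w t)) ->
  (distribution P X \x distribution P w)%E.-integrable setT F.
Proof.
move=> mF iF; apply/integrableP; split=> //.
have -> : (\int[distribution P X \x distribution P w]_x `|F x| =
           \int[distribution P Xw]_x `|F x|)%E.
  by apply: eq_measure_integral => A mA _; exact: joint_lawE.
rewrite ge0_integral_distribution //; first by case/integrableP: iF.
exact: measurableT_comp.
Qed.

Lemma integral_joint_law (F : S * W -> \bar R) : measurable_fun setT F ->
  P.-integrable setT (fun t => F (X t, w t)) ->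
  (\int[distribution P X \x distribution P w]_x F x = \int[P]_t F (X t, w t))%E.
Proof.
move=> mF iF.
have -> : (\int[distribution P X \x distribution P w]_x F x =
           \int[distribution P Xw]_x F x)%E.
  by apply: eq_measure_integral => A mA _; exact: joint_lawE.
by rewrite integral_distribution.
Qed.

Lemma integral_indep (F : S * W -> \bar R) : measurable_fun setT F ->
  P.-integrable setT (fun t => F (X t, w t)) ->
  (\int[P]_t F (X t, w t) =
   \int[distribution P X]_x \int[distribution P w]_u F (x, u))%E.
Proof.
move=> mF iF; rewrite -integral_joint_law //.
by rewrite -integral12_prod_meas1 //; exact: integrable_joint_law.
Qed.

End joint_law.

Section centered_kernel.
Context {dS dW} {S : measurableType dS} {W : measurableType dW}.
Variables (Z : {RV P >-> S}) (w : {RV P >-> W}) (h : S * W -> R).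
Hypotheses (mh : measurable_fun setT h).
Hypothesis ih : P.-integrable setT (fun t => (h (Z t, w t))%:E).
Hypothesis centered : forall B, measurable B ->
  (\int[P]_(t in Z @^-1` B) (h (Z t, w t))%:E = 0)%E.

(** By Fubini the inner mean, as a function of [z], has integral zero over every measurable [B], so
    it vanishes almost everywhere. *)
Lemma centered_kernel : independent2 Z w ->
  {ae distribution P Z, forall z,
    (\int[distribution P w]_u (h (z, u))%:E = 0)%E}.
Proof.
move=> indep.
have mEh : measurable_fun setT (EFin \o h) by exact/measurable_EFinP.
have ih' := integrable_joint_law indep mEh ih.
suff : ae_eq (distribution P Z) setT
    (fubini_F (distribution P w) (EFin \o h)) (cst 0%E).
  by apply: filterS => z /(_ I).
apply: integral_ae_eq => //; first exact: integrable_fubini_F.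
  move=> B _ mB; rewrite integral0.
  have mBW : measurable (B `*` [set: W]) by exact: measurableX.
  pose g := (EFin \o h) \_ (B `*` [set: W]).
  have mg : measurable_fun setT g.
    by apply/(measurable_restrictT _ _).1 => //; exact: measurable_funTS.
  have gE t : g (Z t, w t) = ((fun t => (h (Z t, w t))%:E) \_ (Z @^-1` B)) t.
    rewrite /g !patchE; congr (if _ then _ else _).
    by apply/idP/idP; rewrite !inE /=; [case|].
  have ig : P.-integrable setT (fun t => g (Z t, w t)).
    under eq_fun do rewrite gE.
    have mZB : measurable (Z @^-1` B).
      by rewrite -[X in measurable X]setTI; exact: measurable_funPT.
    apply/(integrable_mkcond _ _).1 => //.
    exact: integrableS ih.
  have g0 : (\int[P]_t g (Z t, w t) = 0)%E.
    by under eq_integral do rewrite gE; rewrite -integral_mkcond centered.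
  rewrite (integral_indep indep mg ig) in g0.
  rewrite -[RHS]g0 integral_mkcond; apply: eq_integral => z _.
  rewrite patchE /fubini_F; case: ifPn => zB.
    by apply: eq_integral => u _; rewrite /g patchE ifT // inE; split=> //; rewrite inE in zB.
  apply/esym; apply: integral0_eq => u _.
  by rewrite /g patchE ifF //; apply/negbTE; apply: contra zB; rewrite !inE /= => -[].
Qed.

(* The inner integral over w vanishes for almost every value of Z, and it is
   insensitive to the extra factor V, which is determined by the past. *)
Lemma integral_centered_mul (V : {RV P >-> R}) :
  independent2 (fun t => (Z t, V t)) w ->
  P.-integrable setT (fun t => (V t * h (Z t, w t))%:E) ->
  (\int[P]_t (V t * h (Z t, w t))%:E = 0)%E.
Proof.
move=> indep iVh.
have indepZ : independent2 Z w.
  move=> A B mA mB; have := indep (A `*` setT) B (measurableX mA measurableT) mB.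
  rewrite (_ : (fun t => (Z t, V t)) @^-1` (A `*` setT) = Z @^-1` A) //.
  by apply/seteqP; split=> t //= [].
pose ZV := mkRV (measurable_fun_pair (measurable_funPT Z) (measurable_funPT V)).
have mF : measurable_fun setT (fun x : S * R * W => (x.1.2 * h (x.1.1, x.2))%:E).
  apply/measurable_EFinP; apply: measurable_funM.
    by apply: (measurableT_comp measurable_snd measurable_fst).
  apply: (measurableT_comp mh); apply: measurable_fun_pair => //.
  by apply: (measurableT_comp measurable_fst measurable_fst).
have mEh : measurable_fun setT (EFin \o h) by exact/measurable_EFinP.
have ih' := ae_integrable1 (integrable_joint_law indepZ mEh ih).
have c := centered_kernel indepZ.
rewrite (integral_indep (X := ZV) indep mF iVh) /=.
rewrite (ae_eq_integral (cst 0%E)) ?integral0 //.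
  exact: measurable_fubini_F (integrable_joint_law (X := ZV) indep mF iVh).
(* Off [N] the function [h (z, _)] is integrable with mean zero, so the factor [v] leaves the inner
   integral. The cylinder over [N] is null for the law of [(Z, V)]. *)
have [N [mN N0 subN]] := filterI ih' c.
exists (N `*` setT); split.
- exact: measurableX.
- rewrite -N0 /distribution /pushforward /=; congr (P _).
  by apply/seteqP; split=> t //= [].
- move=> [z v] /= nzv; split=> //; apply: subN => /= -[iz cz]; apply: nzv => _.
  by under eq_integral do rewrite EFinM; rewrite integralZl // cz mule0.
Qed.

End centered_kernel.

End independence.

(** * Square-integrable random vectors *)

Section square_integrable.
Context {R : realType} {dT} {T : measurableType dT} (P : probability T R) {d : nat}.

Lemma integrable_dominated (X Y : T -> R) : measurable_fun setT X ->
  (forall t, `|X t| <= Y t) -> P.-integrable setT (EFin \o Y) ->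
  P.-integrable setT (EFin \o X).
Proof.
move=> mX XY; apply: le_integrable => //; first exact/measurable_EFinP.
by move=> t _ /=; rewrite lee_fin (le_trans (XY t)) // ler_norm.
Qed.

Lemma integrable_lin (a b : R) (X Y : T -> R) :
  P.-integrable setT (EFin \o X) -> P.-integrable setT (EFin \o Y) ->
  P.-integrable setT (EFin \o (fun t => a * X t + b * Y t)).
Proof.
move=> iX iY.
rewrite (_ : EFin \o _ = (fun t => a%:E * (EFin \o X) t) \+ (fun t => b%:E * (EFin \o Y) t))%E //.
by apply: integrableD => //; exact: integrableZl.
Qed.

Lemma measurable_dotp (X Y : T -> 'rV[R]_d) :
  measurable_fun setT (X : T -> borel_rV R d) ->
  measurable_fun setT (Y : T -> borel_rV R d) ->
  measurable_fun setT (fun t => dotp (X t) (Y t)).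
Proof.
move=> /measurable_rowP mX /measurable_rowP mY.
by apply: measurable_sum => i; exact: measurable_funM.
Qed.

(** The class in which the whole run stays: it is closed under linear combinations, under [grad f]
    and under adding oracle noise, and it makes all expectations below finite. *)
Definition sqint (X : T -> 'rV[R]_d) :=
  measurable_fun setT (X : T -> borel_rV R d) /\
  P.-integrable setT (EFin \o (fun t => dotp (X t) (X t))).

Lemma sqint_cst (c : 'rV[R]_d) : sqint (fun=> c).
Proof. by split; [exact: measurable_cst|exact: finite_measure_integrable_cst]. Qed.

Lemma sqint_dotp (X Y : T -> 'rV[R]_d) : sqint X -> sqint Y ->
  P.-integrable setT (EFin \o (fun t => dotp (X t) (Y t))).
Proof.
move=> [mX iX] [mY iY].
apply: integrable_dominated (integrable_lin 1 1 iX iY); first exact: measurable_dotp.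
move=> t; have := dotp_ge0 (X t + Y t); have := dotp_ge0 (X t - Y t).
rewrite !dotpE (dotpC (Y t) (X t)) ler_norml => *.
by have := dotp_ge0 (X t); have := dotp_ge0 (Y t); lra.
Qed.

Lemma sqint_lin (a b : R) (X Y : T -> 'rV[R]_d) : sqint X -> sqint Y ->
  sqint (fun t => a *: X t + b *: Y t).
Proof.
move=> sX sY; have [[mX iX] [mY iY]] := (sX, sY).
split; first exact: measurable_rV_lin.
rewrite (_ : (fun t => _) = fun t => 1 * ((a * a) * dotp (X t) (X t) + (b * b) * dotp (Y t) (Y t))
   + (2 * a * b) * dotp (X t) (Y t)); last first.
  by apply/funext => t; rewrite !dotpE (dotpC (Y t) (X t)); ring.
by apply: integrable_lin; [exact: integrable_lin|exact: sqint_dotp].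
Qed.

Lemma sqint_coordM (X Y : T -> 'rV[R]_d) (i j : 'I_d) : sqint X -> sqint Y ->
  P.-integrable setT (EFin \o (fun t => X t 0 i * Y t 0 j)).
Proof.
move=> [mX iX] [mY iY].
apply: integrable_dominated (integrable_lin 1 1 iX iY).
  by move/measurable_rowP in mX; move/measurable_rowP in mY; exact: measurable_funM.
move=> t; have := sqr_coord_le (X t) i; have := sqr_coord_le (Y t) j.
move: (X t 0 i) (Y t 0 j) => x y h1 h2.
have := sqr_ge0 (x + y); have := sqr_ge0 (x - y); have := sqr_ge0 x; have := sqr_ge0 y.
by rewrite ler_norml; nra.
Qed.

End square_integrable.

(** * Integrability of the gap, the gradient and the Lyapunov function *)

Section square_integrable_iterates.
Context {R : realType} {dT} {T : measurableType dT} (P : probability T R) {d : nat}.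
Variables (mu L : R) (f : 'rV[R]_d -> R) (xs : 'rV[R]_d).
Hypotheses (mu0 : 0 < mu) (muL : mu <= L).
Hypothesis ssc : smooth_strongly_convex mu L f.
Hypothesis xs_min : forall y, f xs <= f y.

Lemma measurable_subopt (X : T -> 'rV[R]_d) :
  measurable_fun setT (X : T -> borel_rV R d) ->
  measurable_fun setT (fun t => f (X t) - f xs).
Proof.
move=> mX; apply: measurable_funB => //.
apply: (measurableT_comp _ mX); apply: measurable_continuous_real => x.
by case: ssc => df _ _; apply: differentiable_continuous.
Qed.

Lemma measurable_grad : measurable_fun setT (grad f : borel_rV R d -> borel_rV R d).
Proof. by apply: measurable_continuous_rV; case: ssc. Qed.

Lemma sqint_sub (X : T -> 'rV[R]_d) c : sqint P X -> sqint P (fun t => X t - c).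
Proof.
move=> sX; have := sqint_lin 1 (-1) sX (sqint_cst P c).
by under eq_fun do rewrite scale1r scaleN1r.
Qed.

Lemma integrable_subopt (X : T -> 'rV[R]_d) : sqint P X ->
  P.-integrable setT (EFin \o (fun t => f (X t) - f xs)).
Proof.
move=> sX; have [_ iX] := sqint_sub xs sX.
(* The weight 0 turns [integrable_lin] into integrability of a scalar multiple; the dominating
   function is the upper quadratic bound at the minimizer. *)
apply: integrable_dominated (integrable_lin (L / 2) 0 iX iX).
  by case: sX => mX _; exact: measurable_subopt.
move=> t; rewrite mul0r addr0 ger0_norm ?(subopt_ge0 xs_min) //.
exact: (subopt_le mu0 muL ssc xs_min).
Qed.

Lemma sqint_grad (X : T -> 'rV[R]_d) : sqint P X -> sqint P (fun t => grad f (X t)).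
Proof.
move=> sX; have mg : measurable_fun setT ((fun t => grad f (X t)) : T -> borel_rV R d).
  by case: sX => mX _; exact: (measurableT_comp measurable_grad mX).
split=> //.
have iS := integrable_subopt sX.
apply: integrable_dominated (integrable_lin (2 * L) 0 iS iS); first exact: measurable_dotp.
by move=> t; rewrite mul0r addr0 ger0_norm ?dotp_ge0 //; exact: (sqr_grad_le mu0 muL ssc xs_min).
Qed.

Lemma integrable_lyapunov (a : R) (X X' : T -> 'rV[R]_d) : sqint P X -> sqint P X' ->
  P.-integrable setT (EFin \o (fun t => lyapunov mu a f xs (X t) (X' t))).
Proof.
move=> sX sX'; have iS := integrable_subopt sX.
pose b := (Num.sqrt (mu * a))^-1.
have [_ iM] := sqint_sub xs (sqint_lin b (1 - b) sX sX').
have := integrable_lin 1 (mu / 2) iS iM; congr (P.-integrable setT _).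
apply/funext => t /=; rewrite mul1r /lyapunov; congr (_ + _ * _)%:E.
suff -> : mirror mu a (X t) (X' t) = b *: X t + (1 - b) *: X' t by [].
by apply/rowP => i; rewrite /mirror -/b !mxE; ring.
Qed.

End square_integrable_iterates.

(** * The past of a query *)

Section past_of_a_query.
Context {R : realType} {dT} {T : measurableType dT} (P : probability T R).
Context {dW} {W : measurableType dW} {I : choiceType}.

(** A pi-system generating the sigma-algebra of the samples with index in [D]. *)
Definition cylinders (X : I -> {RV P >-> W}) (D : set I) : set_system T :=
  [set S | exists (s : {fset I}) (A : I -> set W),
    [/\ [set` s] `<=` D, forall i, measurable (A i) &
        S = \bigcap_(i in [set` s]) (X i @^-1` A i)]].

Variables (X : I -> {RV P >-> W}) (D : set I).

Lemma measurable_preim_RV i (A : set W) : measurable A -> measurable (X i @^-1` A).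
Proof. by move=> mA; rewrite -[_ @^-1` _]setTI; exact: measurable_funPT. Qed.

Lemma cylinders_measurable : cylinders X D `<=` measurable.
Proof.
move=> _ [s [A [_ mA ->]]]; apply: fin_bigcap_measurable => [|i _].
  exact: finite_fset.
exact: measurable_preim_RV.
Qed.

Lemma cylinders_setI_closed : setI_closed (cylinders X D).
Proof.
move=> _ _ [s [A [sD mA ->]]] [s' [A' [sD' mA' ->]]].
(* Each family is padded with [setT] outside its own index set, so that both can be intersected over
   the union. *)
exists (s `|` s')%fset,
  (fun i => (if i \in s then A i else setT) `&` (if i \in s' then A' i else setT)).
split=> [i /=|i|].
- by rewrite in_fsetU => /orP[/sD|/sD'].
- by apply: measurableI; case: ifP.
- apply/seteqP; split=> t /= => [[h h'] i|h].
    by move=> _; split; case: ifP => // ?; [exact: h|exact: h'].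
  by split=> i /= is_; have := h i; rewrite /= in_fsetU is_ ?orbT => /(_ isT)[].
Qed.

Lemma measurable_cylinder i : D i ->
  @measurable_fun _ _ (g_sigma_algebraType (cylinders X D)) W setT (X i).
Proof.
move=> Di _ A mA; rewrite setTI; apply: sub_sigma_algebra.
exists [fset i]%fset, (fun=> A); split=> //.
  by move=> j /=; rewrite in_fset1 => /eqP ->.
by rewrite set_fset1 bigcap_set1.
Qed.

Lemma independent2_cylinders {dS} {S : measurableType dS} (J : set I) (j : I)
    (Y : T -> S) :
  mutually_independent J X -> D `<=` J -> J j -> ~ D j ->
  @measurable_fun _ _ (g_sigma_algebraType (cylinders X D)) S setT Y ->
  independent2 P Y (X j).
Proof.
move=> indep DJ Jj Dj mY A B mA mB.
have mXB := measurable_preim_RV j mB.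
pose p := NngNum (fine_ge0 (measure_ge0 P (X j @^-1` B))).
have pE : p%:num%:E = P (X j @^-1` B) by rewrite /= fineK // fin_num_measure.
rewrite muleC -pE.
apply: (@g_sigma_algebra_measure_unique _ _ _ _ cylinders_measurable (fun=> setT)
  _ _ (mrestr P mXB) (mscale p P)).
- move=> _; exists fset0, (fun=> setT); split=> //.
  by rewrite set_fset0 bigcap_set0.
- by rewrite bigcup_const.
- exact: cylinders_setI_closed.
- move=> _ [s [C [sD mC ->]]].
  have js : j \notin s by apply/negP => /sD.
  (* Since [j] lies outside [s], a single family can hold both the cylinder's sets and [B];
     independence is then applied over [s] and over [s] with [j] added. *)
  pose C' i := if i == j then B else C i.
  have CE i : i \in s -> C' i = C i.
    by move=> is_; rewrite /C' ifN //; apply: contraNneq js => <-.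
  have -> : \bigcap_(i in [set` s]) (X i @^-1` C i) =
            \bigcap_(i in [set` s]) (X i @^-1` C' i).
    by apply: eq_bigcapr => i /= is_; rewrite CE.
  have mC' i : measurable (C' i) by rewrite /C'; case: ifP.
  have indep_s : P (\bigcap_(i in [set` s]) (X i @^-1` C' i)) =
      (\prod_(i <- s) P (X i @^-1` C' i))%E.
    by apply: indep => // i /sD/DJ.
  have indep_js : P (\bigcap_(i in [set` (j |` s)%fset]) (X i @^-1` C' i)) =
      (\prod_(i <- (j |` s)%fset) P (X i @^-1` C' i))%E.
    by apply: indep => // i /=; rewrite in_fsetU in_fset1 => /orP[/eqP ->//|/sD/DJ].
  rewrite bigcap_fsetU1 // big_fsetU1 //= -indep_s /C' eqxx in indep_js.
  change (P (\bigcap_(i in [set` s]) (X i @^-1` C' i) `&` X j @^-1` B) =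
    (p%:num%:E * P (\bigcap_(i in [set` s]) (X i @^-1` C' i)))%E).
  by rewrite setIC pE; exact: indep_js.
- by move=> _; rewrite /= /mrestr setTI ltey_eq fin_num_measure.
- by have := mY measurableT A mA; rewrite setTI.
Qed.

End past_of_a_query.

(** * Iterates as functions of the past samples *)

Section measurable_iterates.
Context {R : realType} {d : nat} {dW} {W : measurableType dW}.
Context {dS} {S : measurableType dS}.
Variables (mu : R) (alpha : nat -> R) (len : nat -> nat) (x00 : 'rV[R]_d).
Variable G : borel_rV R d * W -> borel_rV R d.
Hypothesis mG : measurable_fun setT G.

(** The source [S] is abstract so that it can later be [T] with only the sigma-algebra of the past;
    measurability then says that the iterate is determined by the past. *)
Lemma measurable_asg_stage (a b : R) (u : nat -> S -> W) (x0 : S -> 'rV[R]_d) m :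
  measurable_fun setT (x0 : S -> borel_rV R d) ->
  (forall j, (0 < j < m)%N -> measurable_fun setT (u j)) ->
  measurable_fun setT
    ((fun s => asg_stage a b (fun j z => G (z, u j s)) (x0 s) m) : S -> borel_rV R d).
Proof.
move=> mx0; elim/ltn_ind: m => -[|[|m]] IH mu_ //.
pose y s : 'rV[R]_d := (1 + b) *: asg_stage a b (fun j z => G (z, u j s)) (x0 s) m.+1
   + (- b) *: asg_stage a b (fun j z => G (z, u j s)) (x0 s) m.
have my : measurable_fun setT (y : S -> borel_rV R d).
  apply: measurable_rV_lin; apply: IH => // j /andP[j0 jm]; apply: mu_;
    by rewrite j0 /= (ltn_trans jm).
have mg : measurable_fun setT ((fun s => G (y s, u m.+1 s)) : S -> borel_rV R d).
  apply: (measurableT_comp mG); apply: measurable_fun_pair => //.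
  by apply: mu_ => /=.
have := measurable_rV_lin 1 (- a) my mg.
congr (measurable_fun setT _); apply/funext => s /=.
by rewrite scale1r /y !scaleNr.
Qed.

(** The inequality [ij.2 < m] is strict because iterate [m] of a stage, counted from 1 at the
    starting point, has used only the queries before [m]. *)
Definition past (k m : nat) : set (nat * nat) :=
  [set ij | [/\ (0 < ij.1)%N, (0 < ij.2)%N &
    (ij.1 < k)%N /\ (ij.2 <= len ij.1)%N \/ ij.1 = k /\ (ij.2 < m)%N]].

Variable u : nat -> nat -> S -> W.
Let sample s i j (z : 'rV[R]_d) := G (z, u i j s).

Lemma measurable_masg_start k :
  (forall ij, past k 0 ij -> measurable_fun setT (u ij.1 ij.2)) ->
  measurable_fun setT
    ((fun s => masg_start mu alpha len (sample s) x00 k) : S -> borel_rV R d).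
Proof.
elim: k => [|[|k] IH] mu_; [exact: measurable_cst|exact: measurable_cst|].
apply: measurable_asg_stage.
  apply: IH => -[i j] [/= i0 j0 [[ik jl]|[]//]]; apply: (mu_ (i, j)).
  by split=> //; left; rewrite ltnW.
move=> j /andP[j0 jl]; apply: (mu_ (k.+1, j)); split=> //=.
by left.
Qed.

Lemma measurable_masg_x k m : (0 < k)%N ->
  (forall ij, past k m ij -> measurable_fun setT (u ij.1 ij.2)) ->
  measurable_fun setT
    ((fun s => masg_x mu alpha len (sample s) x00 k m) : S -> borel_rV R d).
Proof.
move=> k0 mu_; apply: measurable_asg_stage.
  apply: measurable_masg_start => -[i j] [/= i0 j0 [ij|[]//]].
  by apply: (mu_ (i, j)); split=> //; left.
by move=> j /andP[j0 jm]; apply: (mu_ (k, j)); split=> //; right.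
Qed.

End measurable_iterates.

(** * Second moment and orthogonality of the gradient noise *)

Section gradient_noise.
Context {R : realType} {dT} {T : measurableType dT} (P : probability T R) {d : nat}.
Context {dW} {W : measurableType dW}.
Variables (f : 'rV[R]_d -> R) (sigma : R) (G : borel_rV R d * W -> borel_rV R d).
Variables (Z : T -> borel_rV R d) (w : {RV P >-> W}).
Hypothesis mG : measurable_fun setT G.
Hypothesis mgrad : measurable_fun setT (grad f : borel_rV R d -> borel_rV R d).
Hypothesis mZ : measurable_fun setT Z.
Hypothesis oracle : unbiased_bounded_variance P f sigma G Z w.

Definition noise t : 'rV[R]_d := (G (Z t, w t) : 'rV[R]_d) - grad f (Z t).

Lemma measurable_noise : measurable_fun setT (noise : T -> borel_rV R d).
Proof.
have mGZ : measurable_fun setT (fun t => G (Z t, w t)).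
  by apply: (measurableT_comp mG); exact: measurable_fun_pair.
have := measurable_rV_lin 1 (-1) mGZ (measurableT_comp mgrad mZ).
by congr (measurable_fun setT _); apply/funext => t; rewrite scale1r scaleN1r.
Qed.

Lemma sqint_noise : sqint P noise.
Proof.
split; first exact: measurable_noise.
case: oracle => _ [V [iN _ _ _] _]; move: iN; congr (P.-integrable setT _).
by apply/funext => t /=; rewrite enorm_sqr.
Qed.

Lemma sqr_noise_le : \int[P]_t dotp (noise t) (noise t) <= sigma ^+ 2.
Proof.
case: oracle => _ [V [iN iV _ /(_ setT) eNV] Vle].
have /eNV {}eNV : sigma_of Z setT by exists setT => //; rewrite setTI preimage_setT.
rewrite /Rintegral.
have -> : (\int[P]_t (dotp (noise t) (noise t))%:E = \int[P]_t (V t)%:E)%E.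
  by rewrite -eNV; apply: eq_integral => t _; rewrite -enorm_sqr.
rewrite -lee_fin fineK ?integrable_fin_num //.
have ic : P.-integrable setT (EFin \o cst (sigma ^+ 2)).
  exact: finite_measure_integrable_cst.
have mV : measurable_fun setT V by apply/measurable_EFinP; exact: measurable_int iV.
have : (0 <= \int[P]_t ((sigma ^+ 2)%:E - (V t)%:E))%E.
  (* The almost sure bound makes the integrand equal almost everywhere to its absolute value, which
     is nonnegative everywhere. *)
  rewrite (ae_eq_integral (fun t => `|sigma ^+ 2 - V t|%:E)) //.
  - by apply: integral_ge0 => t _; rewrite lee_fin.
  - by apply/measurable_EFinP; exact: measurable_funB.
  - by apply/measurable_EFinP; apply: measurableT_comp => //; exact: measurable_funB.
  - by apply: filterS Vle => t Vt _; rewrite ger0_norm // subr_ge0.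
rewrite (integralB_EFin measurableT ic iV) /=.
have -> : (\int[P]_t (sigma ^+ 2)%:E = (sigma ^+ 2)%:E)%E.
  by rewrite integral_cst //= probability_setT mule1.
by rewrite suber_ge0 ?integrable_fin_num.
Qed.

(** Coordinate by coordinate this is [integral_centered_mul] with [V] a coordinate of [U]; the
    conditional unbiasedness of the oracle is its centering hypothesis. *)
Lemma dotp_noise_mean0 (U : T -> 'rV[R]_d) : sqint P U ->
  (forall i, independent2 P (fun t => (Z t, U t 0 i)) w) ->
  \int[P]_t dotp (U t) (noise t) = 0.
Proof.
move=> sU indep; have sN := sqint_noise.
rewrite /Rintegral /dotp.
under eq_integral do rewrite -sumEFin.
rewrite integral_sum //; last by move=> i; exact: sqint_coordM.
rewrite big1 // => i _.
have [mU _] := sU; move/measurable_rowP in mU.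
pose h (x : borel_rV R d * W) := (G x : 'rV[R]_d) 0 i - (grad f x.1 : 'rV[R]_d) 0 i.
have mh : measurable_fun setT h.
  apply: measurable_funB; first exact: (measurableT_comp (measurable_coord i) mG).
  apply: (measurableT_comp (measurable_coord i)).
  exact: (measurableT_comp mgrad measurable_fst).
have [iG igr _ eG] := oracle.1 i.
have ih : P.-integrable setT (fun t => (h (Z t, w t))%:E).
  have := integrable_lin 1 (-1) iG igr; congr (P.-integrable setT _).
  by apply/funext => t /=; rewrite mul1r mulN1r.
have centered B : measurable B -> (\int[P]_(t in Z @^-1` B) (h (Z t, w t))%:E = 0)%E.
  move=> mB.
  have mZB : measurable (Z @^-1` B) by rewrite -[X in measurable X]setTI; exact: mZ.
  rewrite integralB_EFin //; [|exact: integrableS iG|exact: integrableS igr].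
  rewrite eG; last by exists B => //; rewrite setTI.
  by rewrite subee // integrable_fin_num //; exact: integrableS igr.
have iUh : P.-integrable setT (fun t => (U t 0 i * h (Z t, w t))%:E).
  have := sqint_coordM i i sU sN; congr (P.-integrable setT _).
  by apply/funext => t /=; rewrite /noise 2!mxE.
have := integral_centered_mul (Z := mkRV P mZ) (w := w) mh ih centered
  (V := mkRV P (mU i)) (indep i) iUh.
by move=> <-; apply: eq_integral => t _; rewrite /noise 2!mxE.
Qed.

End gradient_noise.

(** * The recursion along a stage *)

Section noise_weight_regularity.
Context {R : realType} {d : nat}.
Variables (mu L a : R) (f : 'rV[R]_d -> R) (xs : 'rV[R]_d).
Hypothesis mgrad : measurable_fun setT (grad f : borel_rV R d -> borel_rV R d).

(** Nested two-term combinations, the shape that [measurable_rV_lin] and [sqint_lin] handle. *)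
Lemma noise_weightE x y : noise_weight mu L a f xs x y =
  1 *: ((L * a ^+ 2) *: grad f y + - Num.sqrt (mu * a) *: (1 *: y + -1 *: xs)) +
  - (1 - Num.sqrt (mu * a)) *: (1 *: y + -1 *: x).
Proof. by rewrite /noise_weight !scale1r !scaleN1r !scaleNr. Qed.

Lemma measurable_noise_weight {dS} {S : measurableType dS} (X Y : S -> 'rV[R]_d) :
  measurable_fun setT (X : S -> borel_rV R d) ->
  measurable_fun setT (Y : S -> borel_rV R d) ->
  measurable_fun setT
    ((fun s => noise_weight mu L a f xs (X s) (Y s)) : S -> borel_rV R d).
Proof.
move=> mX mY; under eq_fun do rewrite noise_weightE.
apply: measurable_rV_lin; last exact: measurable_rV_lin.
apply: measurable_rV_lin; first exact: (measurableT_comp mgrad mY).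
by apply: measurable_rV_lin => //; exact: measurable_cst.
Qed.

End noise_weight_regularity.

Section expected_lyapunov_decrease.
Context {R : realType} {dT} {T : measurableType dT} (P : probability T R) {d : nat}.
Context {dW} {W : measurableType dW}.
Variables (mu L : R) (f : 'rV[R]_d -> R) (xs : 'rV[R]_d) (sigma : R).
Variables (G : borel_rV R d * W -> borel_rV R d) (w : nat -> nat -> {RV P >-> W}).
Variables (alpha : nat -> R) (len : nat -> nat) (x00 : 'rV[R]_d).
Let sample t k m (z : 'rV[R]_d) := G (z, w k m t).
Let Y k m t := masg_y mu alpha len (sample t) x00 k m.
Let X k m t := masg_x mu alpha len (sample t) x00 k m.
Let start k t := masg_start mu alpha len (sample t) x00 k.
Let q k := Num.sqrt (mu * alpha k).
Hypotheses (mu0 : 0 < mu) (muL : mu <= L).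
Hypothesis ssc : smooth_strongly_convex mu L f.
Hypothesis xs_min : forall y, f xs <= f y.
Hypothesis mG : measurable_fun setT G.
Hypothesis indep : mutually_independent [set km | 1 <= km.1 /\ 1 <= km.2 <= len km.1]%N
  (fun km : nat * nat => w km.1 km.2).
Hypothesis oracle : forall k m, (1 <= k)%N -> (1 <= m <= len k)%N ->
  unbiased_bounded_variance P f sigma G (Y k m) (w k m).
Hypothesis alpha_gt0 : forall k, (1 <= k)%N -> 0 < alpha k.
Hypothesis alphaL_le1 : forall k, (1 <= k)%N -> alpha k * L <= 1.

Let mgrad := measurable_grad ssc.
Let gap k m := \int[P]_t (f (X k m t) - f xs).
(** The Lyapunov function after [m] gradient steps of stage [k]: [X k 0] and [X k 1] both are the
    stage's starting point. *)
Let V k m t := lyapunov mu (alpha k) f xs (X k m.+1 t) (X k m t).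

Lemma masg_x_step k m t : (0 < k)%N -> (0 < m)%N ->
  X k m.+1 t = Y k m t - alpha k *: (grad f (Y k m t) + noise f G (Y k m) (w k m) t).
Proof. by move=> k0 m0; rewrite /X masg_xE // /noise [grad f _ + _]addrC subrK. Qed.

(** Induction over stages, and inside a stage over steps. The oracle controls the noise only for
    queries up to [len k], which yields the iterates up to [(len k).+1], the last being the next
    start. *)
Lemma sqint_masg_x k m : (0 < k)%N -> (m <= (len k).+1)%N -> sqint P (X k m).
Proof.
have sStage j : (0 < j)%N -> sqint P (start j) ->
    forall m, (m <= (len j).+1)%N -> sqint P (X j m).
  move=> j0 s0; elim/ltn_ind => -[|[|i]] IH // im.
  have sX1 : sqint P (X j i.+1) by apply: IH; rewrite // ltnW.
  have sX0 : sqint P (X j i) by apply: IH; [exact: ltnW|rewrite ltnW // ltnW].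
  have sY : sqint P (Y j i.+1).
    have := sqint_lin (1 + momentum mu (alpha j)) (- momentum mu (alpha j)) sX1 sX0.
    by under eq_fun do rewrite scaleNr.
  have [mY _] := sY.
  have sN : sqint P (noise f G (Y j i.+1) (w j i.+1)).
    exact: (sqint_noise mG mgrad mY (oracle (m := i.+1) j0 im)).
  have sg : sqint P (fun t => grad f (Y j i.+1 t)) by exact: (sqint_grad mu0 muL ssc xs_min).
  have := sqint_lin 1 (- alpha j) sY (sqint_lin 1 1 sg sN).
  congr (sqint P _); apply/funext => t.
  by rewrite masg_x_step // !scale1r scaleNr.
move=> k0; apply: (sStage) => //; elim: k k0 => // -[|k] IH _.
  exact: sqint_cst.
by apply: (sStage k.+1) => //; exact: IH.
Qed.

Lemma sqint_masg_y k m : (0 < k)%N -> (m <= (len k).+1)%N -> sqint P (Y k m).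
Proof.
move=> k0 mk.
have := sqint_lin (1 + momentum mu (alpha k)) (- momentum mu (alpha k))
  (sqint_masg_x k0 mk) (sqint_masg_x k0 (leq_trans (leq_pred m) mk)).
by under eq_fun do rewrite scaleNr.
Qed.

(** The query point and the noise weight are measurable for the sigma-algebra of the samples in
    [past len k m], and [(k, m)] is not among them. *)
Lemma query_independent k m (U : T -> 'rV[R]_d) i : (0 < k)%N -> (0 < m <= len k)%N ->
  U = (fun t => noise_weight mu L (alpha k) f xs (X k m t) (Y k m t)) ->
  independent2 P (fun t => (Y k m t : borel_rV R d, U t 0 i)) (w k m).
Proof.
move=> k0 /andP[m0 mk] ->.
pose D := past len k m; pose w' (km : nat * nat) := w km.1 km.2.
(* [S] is the set [T] equipped with the sigma-algebra of the past only. *)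
pose S := g_sigma_algebraType (cylinders w' D).
have mwS ij : D ij -> measurable_fun setT (w ij.1 ij.2 : S -> W).
  by move=> Dij; apply: (measurable_cylinder (X := w')).
have mXS : measurable_fun setT (X k m : S -> borel_rV R d).
  exact: (measurable_masg_x mu alpha x00 mG (u := fun i j => w i j : S -> W)).
have mXS' : measurable_fun setT (X k m.-1 : S -> borel_rV R d).
  apply: (measurable_masg_x mu alpha x00 mG (u := fun i j => w i j : S -> W)) => // ij.
  move=> [i0 j0 ijkm]; apply: mwS; split=> //.
  by case: ijkm => [|[-> jm]]; [left|right; split=> //; rewrite (leq_trans jm) // leq_pred].
have mYS : measurable_fun setT (Y k m : S -> borel_rV R d).
  have := measurable_rV_lin (1 + momentum mu (alpha k)) (- momentum mu (alpha k)) mXS mXS'.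
  by under eq_fun do rewrite scaleNr.
have := @independent2_cylinders _ _ _ P _ _ _ w' D _ _ _ (k, m)
  (fun t => (Y k m t : borel_rV R d, noise_weight mu L (alpha k) f xs (X k m t) (Y k m t) 0 i))
  indep.
apply.
- move=> [i' j'] [/= i0 j0 [[ik jl]|[ik jm]]]; split=> //=.
    by rewrite jl j0.
  by rewrite ik (leq_trans (ltnW jm)) // j0.
- by split=> //=; rewrite m0.
- by move=> [_ _ /= [[]|[_]]]; rewrite ltnn.
- apply: (@measurable_fun_pair _ _ _ S) => //.
  apply: (measurableT_comp (measurable_coord i)).
  exact: (measurable_noise_weight mu L (alpha k) xs mgrad mXS mYS).
Qed.

Lemma integrable_V k m : (0 < k)%N -> (m <= len k)%N -> P.-integrable setT (EFin \o V k m).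
Proof.
move=> k0 mk; apply: (integrable_lyapunov mu0 muL ssc xs_min).
  exact: sqint_masg_x.
by apply: sqint_masg_x => //; rewrite ltnW.
Qed.

Lemma expected_lyapunov_step k m : (0 < k)%N -> (m < len k)%N ->
  \int[P]_t V k m.+1 t <= (1 - q k) * \int[P]_t V k m t + alpha k * sigma ^+ 2.
Proof.
move=> k0 mk.
pose N := noise f G (Y k m.+1) (w k m.+1).
pose U t := noise_weight mu L (alpha k) f xs (X k m.+1 t) (Y k m.+1 t).
have sX : sqint P (X k m.+1) by exact: (sqint_masg_x (m := m.+1) k0 (leqW mk)).
have sY : sqint P (Y k m.+1) by exact: (sqint_masg_y (m := m.+1) k0 (leqW mk)).
have [mY _] := sY.
have sN : sqint P N by exact: (sqint_noise mG mgrad mY (oracle (m := m.+1) k0 mk)).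
have sU : sqint P U.
  rewrite /U; under eq_fun do rewrite noise_weightE.
  apply: sqint_lin; last exact: sqint_lin.
  apply: sqint_lin; first exact: (sqint_grad mu0 muL ssc xs_min).
  by apply: sqint_lin => //; exact: sqint_cst.
have UN0 : \int[P]_t dotp (U t) (N t) = 0.
  apply: (dotp_noise_mean0 mG mgrad mY (oracle (m := m.+1) k0 mk)) => // i.
  exact: (query_independent (m := m.+1) i k0 mk (erefl U)).
have NN : \int[P]_t dotp (N t) (N t) <= sigma ^+ 2.
  exact: (sqr_noise_le (oracle (m := m.+1) k0 mk)).
have iV := integrable_V k0 (ltnW mk); have iV1 := integrable_V k0 mk.
have [_ iNN] := sN; have iUN := sqint_dotp sU sN.
have iVN := integrable_lin (1 - q k) (alpha k) iV iNN.
apply: (@le_trans _ _ (\int[P]_t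
    ((1 - q k) * V k m t + alpha k * dotp (N t) (N t) + dotp (U t) (N t)))).
  apply: le_Rintegral => //.
    have := integrable_lin 1 1 iVN iUN; congr (P.-integrable setT _).
    by apply/funext => t /=; rewrite !mul1r.
  move=> t _; rewrite /V masg_x_step //.
  exact: (lyapunov_step xs mu0 muL (alpha_gt0 k0) (alphaL_le1 k0) ssc).
rewrite (RintegralD measurableT iVN iUN) UN0 addr0.
rewrite (RintegralD measurableT (integrableZl measurableT (1 - q k) iV)
  (integrableZl measurableT (alpha k) iNN)).
rewrite !RintegralZl // lerD2l ler_pM2l //; exact: alpha_gt0.
Qed.

(** The noise term is the fixed point of one step, [(1 - q) * (alpha / q) + alpha = alpha / q], so
    it does not grow with [m]; the factor 2 comes from [lyapunov_start]. *)
Lemma stage_gap_le k m : (0 < k)%N -> (m <= len k)%N ->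
  gap k m.+1 <= 2 * (1 - q k) ^+ m * \int[P]_t (f (start k t) - f xs)
                + alpha k / q k * sigma ^+ 2.
Proof.
move=> k0 mk.
have a0 := alpha_gt0 k0; have q0 : 0 < q k := rate_gt0 mu0 a0.
have q1 : q k <= 1 := rate_le1 muL a0 (alphaL_le1 k0).
have sS : sqint P (start k) by exact: (@sqint_masg_x k 0 k0).
have iS := integrable_subopt mu0 muL ssc xs_min sS.
apply: (@le_trans _ _ (\int[P]_t V k m t)).
  apply: le_Rintegral => //.
  - exact/(integrable_subopt mu0 muL ssc xs_min)/sqint_masg_x.
  - exact: integrable_V.
  - by move=> t _; exact: subopt_le_lyapunov.
have noise_ge0 : 0 <= alpha k / q k * sigma ^+ 2.
  by rewrite mulr_ge0 ?sqr_ge0 // divr_ge0 // ltW.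
elim: m mk => [_|m IH mk].
  rewrite expr0 mulr1 ler_wpDr // -RintegralZl //.
  apply: le_Rintegral => //; first exact: integrable_V.
    exact: (integrableZl measurableT 2 iS).
  by move=> t _; exact: (lyapunov_start _ mu0 muL ssc xs_min).
apply: le_trans (expected_lyapunov_step k0 mk) _.
have q1' : 0 <= 1 - q k by rewrite subr_ge0.
have := ler_wpM2l q1' (IH (ltnW mk)).
rewrite -(lerD2r (alpha k * sigma ^+ 2)) => /le_trans; apply.
rewrite [(1 - q k) ^+ m.+1]exprS.
by rewrite le_eqVlt; apply/orP; left; apply/eqP; field; rewrite gt_eqF.
Qed.

End expected_lyapunov_decrease.

(** * The schedule *)

Section schedule_bounds.
Context {R : realType}.

(** Eight factors [1 + 3 / 32] already exceed 2, and each is at most [expR (3 / 32)]. *)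
Lemma ln2_le : ln (2 : R) <= 3 / 4.
Proof.
rewrite -[leRHS]expRK ler_ln ?posrE ?expR_gt0 //.
have -> : (3 / 4 : R) = 8%:R * (3 / 32) by field.
rewrite expRM_natl; apply: (@le_trans _ _ ((1 + 3 / 32) ^+ 8)); first by lra.
by rewrite lerXn2r ?nnegrE ?expR_ge0 ?expR_ge1Dx //; lra.
Qed.

Lemma expr1B_le_expR (q : R) n : q <= 1 -> (1 - q) ^+ n <= expR (- (q * n%:R)).
Proof.
move=> q1; rewrite -mulNr expRM_natr lerXn2r ?nnegrE ?expR_ge0 ?subr_ge0 //.
exact: expR_ge1Dx.
Qed.

Lemma expr1B_le_inv (q y : R) n : q <= 1 -> 0 < y -> ln y <= q * n%:R ->
  (1 - q) ^+ n <= y^-1.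
Proof.
move=> q1 y0 lnq; apply: le_trans (expr1B_le_expR n q1) _.
by rewrite -[y in leRHS]lnK ?posrE // -expRN ler_expR lerN2.
Qed.

(** With [u = s / 2 ^+ k.+2], the inherited noise [8 * u] shrinks to at most [2 * u] and the new
    stage adds [u]; the total [3 * u] is below the allowed [4 * u]. *)
Lemma noisy_geometric_decay (rho A s : R) (g : nat -> R) :
  0 <= rho -> rho <= 1 / 4 -> 0 <= s -> g 0 <= A + s ->
  (forall k, g k.+1 <= rho * g k + s / 2 ^+ k.+2) ->
  forall k, g k <= rho ^+ k * A + 4 * s / 2 ^+ k.+1.
Proof.
move=> rho0 rho1 s0 g0 gS; elim=> [|k IH]; first by rewrite expr0 expr1; lra.
apply: le_trans (gS k) _.
have := ler_wpM2l rho0 IH.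
have : rho * (4 * s / 2 ^+ k.+1) <= 1 / 4 * (4 * s / 2 ^+ k.+1).
  by rewrite ler_wpM2r // divr_ge0 ?exprn_ge0 // mulr_ge0.
have -> : 4 * s / 2 ^+ k.+1 = 8 * (s / 2 ^+ k.+2).
  by rewrite [2 ^+ k.+2]exprS; field; rewrite expf_neq0.
have -> : 4 * s / 2 ^+ k.+2 = 4 * (s / 2 ^+ k.+2) by rewrite mulrA.
have : 0 <= s / 2 ^+ k.+2 by rewrite divr_ge0 ?exprn_ge0.
by rewrite [rho ^+ k.+1]exprS; lra.
Qed.

(* 1 + c / r <= exp (c / r) keeps the r-th power of the lower-order term of the
   horizon bound below exp c, uniformly in r. *)
Lemma powR_horizon_le (x N r c kappa sk : R) :
  0 <= x -> 0 < N -> 0 < r -> 0 <= c -> 0 <= sk -> sk <= kappa ->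
  N <= x * sk * (r + c) -> N `^ r <= expR c * (x * (r * kappa)) `^ r.
Proof.
move=> x0 N0 r0 c0 sk0 sk_le Nle.
have rn0 : r != 0 by rewrite gt_eqF.
have kap0 : 0 <= kappa := le_trans sk0 sk_le.
have -> : expR c = expR (c / r) `^ r by rewrite -expRM divfK.
rewrite -powRM ?expR_ge0 ?mulr_ge0 ?(ltW r0) //.
rewrite ge0_ler_powR ?nnegrE ?(ltW N0) ?(ltW r0) //.
  by rewrite !mulr_ge0 ?expR_ge0 ?(ltW r0).
apply: le_trans Nle _.
have -> : r + c = r * (1 + c / r) by rewrite mulrDr mulr1 mulrC divfK.
move: (c / r) (divr_ge0 c0 (ltW r0)) (expR_ge1Dx (c / r)) => y y0 ey.
have -> : x * sk * (r * (1 + y)) = x * r * (sk * (1 + y)) by ring.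
have -> : expR y * (x * (r * kappa)) = x * r * (kappa * expR y) by ring.
rewrite ler_wpM2l ?mulr_ge0 ?(ltW r0) //.
by apply: ler_pM => //; rewrite addr_ge0.
Qed.

End schedule_bounds.

Section schedule.
Context {R : realType}.
Variables (mu L p : R) (len : nat -> nat).
Hypotheses (mu0 : 0 < mu) (muL : mu <= L) (p1 : 1 <= p).
Let kappa := L / mu.
Let sk : R := Num.sqrt kappa.

Lemma kappa_ge1 : 1 <= kappa.
Proof. by rewrite ler_pdivlMr // mul1r. Qed.

Lemma sqrt_kappa_ge1 : 1 <= sk.
Proof. by rewrite -[leLHS]sqrtr1 ler_sqrt ?kappa_ge1 // (le_trans ler01 kappa_ge1). Qed.

Lemma sqrt_kappa_le : sk <= kappa.
Proof.
have sk1 := sqrt_kappa_ge1.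
rewrite -[leRHS]sqr_sqrtr ?(le_trans ler01 kappa_ge1) // expr2 ler_peMl //.
exact: le_trans ler01 sk1.
Qed.

Lemma stage_rate k : Num.sqrt (mu * (1 / (2 ^+ (2 * k) * L))) = (2 ^+ k * sk)^-1.
Proof.
have sk0 : 0 < sk := lt_le_trans ltr01 sqrt_kappa_ge1.
have L0 : 0 < L := lt_le_trans mu0 muL.
have c0 : 0 < 2 ^+ k * sk by rewrite mulr_gt0 ?exprn_gt0.
rewrite -[RHS]ger0_norm ?invr_ge0 ?(ltW c0) // -sqrtr_sqr; congr Num.sqrt.
rewrite exprVn exprMn sqr_sqrtr ?(le_trans ler01 kappa_ge1) // -exprM mulnC /kappa.
by field; rewrite expf_neq0 // !gt_eqF.
Qed.

Variable M : R.
Hypothesis M_def : M = (Num.ceil (sk * ln (2 `^ (p + 2))))%:~R.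
Hypothesis len_geo : forall k, (2 <= k)%N -> (len k)%:R = 2 ^+ k * M.

(** The stages after the first have total length below [2 ^+ k.+3 * M]. As [len 1] is at most half
    of [n], it is absorbed by doubling this. *)
Lemma horizon_le k n : (n <= stage_end len k.+2)%N -> (2 * len 1 <= n)%N ->
  n%:R <= 12 * 2 ^+ k * sk * (p + 1 + 7 / 3).
Proof.
move=> nle n2.
(* The geometric sum starts at the exponent 2, whence the correction [4 * M]. *)
have endE j : (stage_end len j.+1)%:R + 4 * M = (len 1)%:R + 2 ^+ j.+2 * M.
  elim: j => [|j IH]; first by rewrite /stage_end big_nat1 expr2; congr (_ + _ * _); ring.
  rewrite /stage_end big_nat_recr //= -/(stage_end len j.+1) natrD len_geo //.
  by rewrite addrAC IH [2 ^+ j.+3]exprS; ring.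
have M0 : 0 <= M.
  rewrite -(@pmulr_rge0 _ (2 ^+ 2)) ?exprn_gt0 // -len_geo //.
have M_le : M <= sk * ((p + 2) * ln 2) + 1.
  have := ceilB1_lt (sk * ln (2 `^ (p + 2))).
  by rewrite intrB -M_def ln_powR; lra.
have n_le : n%:R <= (len 1)%:R + 2 ^+ k.+3 * M.
  by rewrite -endE ler_wpDr ?mulr_ge0 // ler_nat.
have n_ge : 2 * (len 1)%:R <= n%:R :> R by rewrite -natrM ler_nat.
have {n_le n_ge} n_le : n%:R <= 16 * 2 ^+ k * M.
  have -> : 16 * 2 ^+ k * M = 2 * (2 ^+ k.+3 * M) by rewrite !exprS; ring.
  by lra.
apply: le_trans n_le _.
have sk1 := sqrt_kappa_ge1.
(* The summand 1 is the rounding error of the ceiling, absorbed through [1 <= sk]; 3/4 is the bound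
   on [ln 2]. The constants 12 and 7/3 come from [16 * (3 / 4 * (p + 2) + 1)]. *)
have -> : 12 * 2 ^+ k * sk * (p + 1 + 7 / 3) = 16 * 2 ^+ k * (sk * (3 / 4 * (p + 2) + 1)) by field.
rewrite ler_wpM2l ?mulr_ge0 ?exprn_ge0 //; apply: le_trans M_le _.
have := @ln2_le R; move: (ln 2) => l2 l2_le.
have : 0 <= sk * ((p + 2) * (3 / 4 - l2)).
  apply: mulr_ge0; first exact: le_trans ler01 sk1.
  by apply: mulr_ge0; rewrite ?subr_ge0 // addr_ge0 // (le_trans ler01 p1).
by lra.
Qed.

End schedule.

(** * Chaining the stages *)

Theorem corollary3p7 (R : realType) :
  exists2 C0 : R, 0 < C0 &
  forall (d : nat) (mu L : R) (f : 'rV[R]_d -> R) (xstar : 'rV[R]_d) (p : R)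
    (dT : measure_display) (T : measurableType dT) (P : probability T R)
    (dW : measure_display) (W : measurableType dW)
    (sigma : R) (G : borel_rV R d * W -> borel_rV R d)
    (w : nat -> nat -> {RV P >-> W})
    (alpha : nat -> R) (len : nat -> nat) (x00 : 'rV[R]_d),
  let kappa := L / mu in
  let sample t k m z := G (z, w k m t) in
  let query k m t := masg_y mu alpha len (sample t) x00 k m in
  let x n t := masg_iterate mu alpha len (sample t) x00 n in
  0 < mu -> mu <= L ->
  smooth_strongly_convex mu L f ->
  (forall y, f xstar <= f y) ->
  1 <= p ->
  0 <= sigma ->
  measurable_fun setT G ->
  mutually_independent [set km | 1 <= km.1 /\ 1 <= km.2 <= len km.1]%N
    (fun km : nat * nat => w km.1 km.2) ->
  (forall k m, (1 <= k)%N -> (1 <= m <= len k)%N ->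
    unbiased_bounded_variance P f sigma G (query k m) (w k m)) ->
  alpha 1%N = 1 / L ->
  (len 1%N)%:Z = Num.ceil ((p + 1) * Num.sqrt kappa * ln (12 * (p + 1) * kappa)) ->
  (forall k, (2 <= k)%N ->
    (len k)%:Z = 2 ^+ k * Num.ceil (Num.sqrt kappa * ln (2 `^ (p + 2)))) ->
  (forall k, (2 <= k)%N -> alpha k = 1 / (2 ^+ (2 * k) * L)) ->
  forall n : nat, (2 * len 1 <= n)%N ->
  ('E_P[fun t => f (x n t)] - (f xstar)%:E <=
   (C0 * (1 / n%:R `^ (p + 1) * (f x00 - f xstar)
          + (p + 1) * sigma ^+ 2 / (n%:R * mu)))%:E)%E.
Proof.
(* The exponential term serves the bias, 111 the variance. *)
exists (111 + 4 * expR (7 / 3)); first by rewrite addr_gt0 // mulr_gt0 ?expR_gt0.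
move=> d mu L f xs p dT T P dW W sigma G w alpha len x00 kappa sample query x.
move=> mu0 muL ssc xs_min p1 sigma0 mG indep oracle alpha1 len1 lenS alphaS n n2.
have L0 : 0 < L := lt_le_trans mu0 muL.
pose sk : R := Num.sqrt kappa.
have sk1 : 1 <= sk := sqrt_kappa_ge1 mu0 muL.
have sk0 : 0 < sk := lt_le_trans ltr01 sk1.
have kap1 : 1 <= kappa := kappa_ge1 mu0 muL.
have r0 : 0 < p + 1 by rewrite addr_gt0 // (lt_le_trans ltr01 p1).
pose B := 12 * (p + 1) * kappa.
have B1 : 1 < B.
  have : 1 <= (p + 1) * kappa by rewrite -[leLHS]mulr1 ler_pM //; lra.
  by rewrite /B -mulrA; lra.
have B0 : 0 < B := lt_trans ltr01 B1.
pose M : R := (Num.ceil (sk * ln (2 `^ (p + 2))))%:~R.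
have M_ge : sk * ln (2 `^ (p + 2)) <= M := ceil_ge _.
have len1_ge : (p + 1) * sk * ln B <= (len 1)%:R.
  by rewrite -[(len 1)%:R]/((len 1)%:Z%:~R) len1 ceil_ge.
have len_geo k : (2 <= k)%N -> (len k)%:R = 2 ^+ k * M.
  by move=> k2; rewrite -[(len k)%:R]/((len k)%:Z%:~R) lenS // intrM rmorphXn.
have M0 : 0 < M.
  apply: lt_le_trans M_ge; rewrite ln_powR mulr_gt0 // mulr_gt0 ?ln_gt0 ?ltr1n //.
  by rewrite addr_gt0 // (lt_le_trans ltr01 p1).
have len_gt0 k : (0 < k)%N -> (0 < len k)%N.
  case: k => // -[|k] _; rewrite -(ltr_nat R).
    by apply: lt_le_trans len1_ge; rewrite !mulr_gt0 ?ln_gt0.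
  by rewrite len_geo // mulr_gt0 ?exprn_gt0.
(* Stage 1 has exponent 0 instead of the 1 that the general formula would give, hence the case
   distinction. *)
have alphaE k : alpha k.+1 = 1 / (2 ^+ (2 * (if k is 0 then 0 else k.+1)) * L).
  by case: k => [|k]; [rewrite alpha1 muln0 expr0 [1 * L]mul1r|rewrite alphaS].
have alpha_gt0 k : (1 <= k)%N -> 0 < alpha k.
  by case: k => // k _; rewrite alphaE divr_gt0 // mulr_gt0 ?exprn_gt0.
have alphaL k : (1 <= k)%N -> alpha k * L <= 1.
  case: k => // k _; rewrite alphaE.
  have -> : 1 / (2 ^+ (2 * (if k is 0 then 0 else k.+1)) * L) * L =
      (2 ^+ (2 * (if k is 0 then 0 else k.+1)))^-1.
    by field; rewrite expf_neq0 // gt_eqF.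
  by rewrite invf_le1 ?exprn_gt0 // exprn_ege1 //; lra.
have rateE k : Num.sqrt (mu * alpha k.+1) = (2 ^+ (if k is 0 then 0 else k.+1) * sk)^-1.
  by rewrite alphaE stage_rate.
have rate_le1 k : Num.sqrt (mu * alpha k.+1) <= 1.
  exact: (rate_le1 muL (alpha_gt0 k.+1 isT) (alphaL k.+1 isT)).
have stage := stage_gap_le mu0 muL ssc xs_min mG indep oracle alpha_gt0 alphaL.
(* The noise floor [alpha / q * sigma ^+ 2] of stage 1; for stage [k >= 2] it is divided by
   [2 ^+ k]. *)
pose s := sigma ^+ 2 / (mu * sk).
have s0 : 0 <= s by rewrite divr_ge0 ?sqr_ge0 // mulr_ge0 // ltW.
have noiseE k : alpha k.+1 / Num.sqrt (mu * alpha k.+1) * sigma ^+ 2 =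
    s / 2 ^+ (if k is 0 then 0 else k.+1).
  have q0 := rate_gt0 mu0 (alpha_gt0 k.+1 isT).
  have -> : alpha k.+1 / Num.sqrt (mu * alpha k.+1) = Num.sqrt (mu * alpha k.+1) / mu.
    apply: (mulIf (lt0r_neq0 q0)); rewrite divfK ?lt0r_neq0 // mulrAC -expr2.
    by rewrite (rate_sqr mu0 (alpha_gt0 k.+1 isT)) mulrC mulKf ?lt0r_neq0.
  rewrite rateE /s; field.
  by rewrite expf_neq0 // !gt_eqF.
pose a0 := f x00 - f xs.
have a0_ge0 : 0 <= a0 by rewrite subr_ge0.
pose gap k m := \int[P]_t (f (masg_x mu alpha len (sample t) x00 k m) - f xs).
have start1 : \int[P]_t (f (masg_start mu alpha len (sample t) x00 1) - f xs) = a0.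
  by rewrite /= Rintegral_cst //= probability_setT mulr1.
(* The gap at the end of stage [i.+1], which is by computation the gap at the start of stage
   [i.+2]. *)
pose g i := gap i.+1 (len i.+1).+1.
pose rho := (2 `^ (p + 1))^-1 : R.
pose A := 2 * (B `^ (p + 1))^-1 * a0.
have stageS i m : (m <= len i.+2)%N -> gap i.+2 m.+1 <=
    2 * (1 - (2 ^+ i.+2 * sk)^-1) ^+ m * g i + s / 2 ^+ i.+2.
  by move=> mi; have := stage i.+2 m isT mi; rewrite noiseE rateE.
have g0_le : g 0 <= A + s.
  have := stage 1%N (len 1) isT (leqnn _); rewrite noiseE rateE start1 /= expr0 mul1r divr1.
  move=> /le_trans; apply; rewrite lerD2r /A ler_wpM2r // ler_wpM2l //.
  apply: expr1B_le_inv; first by rewrite invf_le1.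
    by rewrite powR_gt0.
  by rewrite ln_powR ler_pdivlMl // mulrCA mulrA.
have gS_le i : g i.+1 <= rho * g i + s / 2 ^+ i.+2.
  apply: le_trans (stageS i _ (leqnn _)) _; rewrite lerD2r.
  have gi0 : 0 <= g i by apply: Rintegral_ge0 => t _; rewrite subr_ge0.
  rewrite ler_wpM2r //.
  (* The exponent [p + 2] in the stage lengths pays for the factor 2 lost at each restart. *)
  have -> : rho = 2 * (2 `^ (p + 2))^-1.
    have -> : p + 2 = p + 1 + 1 by ring.
    rewrite (@powRD _ 2 (p + 1) 1) ?powRr1 ?pnatr_eq0 ?implybT // /rho.
    by field; rewrite gt_eqF // powR_gt0.
  rewrite ler_wpM2l //.
  have c0 : 0 < 2 ^+ i.+2 * sk by rewrite mulr_gt0 ?exprn_gt0.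
  apply: expr1B_le_inv.
  - by have := rate_le1 i.+1; rewrite rateE.
  - by rewrite powR_gt0.
  - rewrite ler_pdivlMl // len_geo // -mulrA ler_pM2l ?exprn_gt0 //.
have rho_ge0 : 0 <= rho by rewrite invr_ge0 powR_ge0.
have rho_le : rho <= 1 / 4.
  rewrite /rho div1r lef_pV2 ?posrE ?powR_gt0 //.
  have -> : (4 : R) = 2 `^ 2%:R by rewrite powR_mulrn //; ring.
  by apply: ler_powR; lra.
have g_le := noisy_geometric_decay rho_ge0 rho_le s0 g0_le gS_le.
have n0 : (0 < n)%N by apply: leq_trans n2; rewrite muln_gt0 len_gt0.
have := stage_ofP len_gt0 n0; case KE : (stage_of len n) => [|[|k]] [//] _ /andP[n_gt n_le].
  (* Stage 1 is excluded: [n] is at least twice its positive length. *)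
  move: n_le; rewrite /stage_end big_nat1 => /(leq_trans n2).
  by rewrite leqNgt mul2n -addnn -[ltnLHS]addn0 ltn_add2l len_gt0.
rewrite /= in n_gt.
pose m := (n - stage_end len k.+1)%N.
have mk : (m <= len k.+2)%N.
  by rewrite leq_subLR; move: n_le; rewrite /stage_end [X in (_ <= X)%N]big_nat_recr.
have xE t : x n t = masg_x mu alpha len (sample t) x00 k.+2 m.+1.
  by rewrite /x /masg_iterate gtn_eqF // KE.
have EgapE : ('E_P[fun t => f (x n t)] - (f xs)%:E = (gap k.+2 m.+1)%:E)%E.
  have sx : sqint P (fun t => masg_x mu alpha len (sample t) x00 k.+2 m.+1).
    exact: (sqint_masg_x mu0 muL ssc xs_min mG oracle (k := k.+2) (m := m.+1) isT mk).
  have igap := integrable_subopt mu0 muL ssc xs_min sx.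
  have ics : P.-integrable setT (EFin \o cst (f xs)) by exact: finite_measure_integrable_cst.
  rewrite unlock.
  have -> : (\int[P]_t (f (x n t))%:E = (gap k.+2 m.+1)%:E + (f xs)%:E)%E.
    rewrite /gap /Rintegral fineK ?integrable_fin_num //.
    have <- : (\int[P]_t (f xs)%:E = (f xs)%:E)%E.
      by rewrite integral_cst //= probability_setT mule1.
    rewrite -(integralD_EFin measurableT igap ics); apply: eq_integral => t _ /=.
    by rewrite xE -EFinD subrK.
  by rewrite addeK.
rewrite EgapE lee_fin.
have nR0 : 0 < n%:R :> R by rewrite ltr0n.
have nr0 : 0 < n%:R `^ (p + 1) :> R by rewrite powR_gt0.
have n_horizon := horizon_le mu0 muL p1 (erefl M) len_geo n_le n2.
(* In the running stage the contraction is only bounded by 1, leaving twice the previous gap: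
   [2 * 8 + 1 = 17] units of noise. *)
have gap_le : gap k.+2 m.+1 <= 2 * (rho ^+ k * A) + 17 * (s / 2 ^+ k.+2).
  apply: le_trans (stageS k m mk) _.
  have gk0 : 0 <= g k by apply: Rintegral_ge0 => t _; rewrite subr_ge0.
  have : (1 - (2 ^+ k.+2 * sk)^-1) ^+ m <= 1.
    have := rate_le1 k.+1; rewrite rateE => q1.
    by rewrite exprn_ile1 ?subr_ge0 // gerBl invr_ge0 mulr_ge0 ?exprn_ge0 // ltW.
  move=> /(ler_wpM2r gk0); rewrite mul1r => c_le.
  have := g_le k; rewrite -/A.
  have -> : 4 * s / 2 ^+ k.+1 = 8 * (s / 2 ^+ k.+2).
    by rewrite [2 ^+ k.+2]exprS; field; rewrite expf_neq0.
  by rewrite -mulrA; lra.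
have kB0 : 0 < 2 ^+ k * B by apply: mulr_gt0 => //; exact: exprn_gt0.
have bias_le : 2 * (rho ^+ k * A) <= 4 * expR (7 / 3) * (1 / n%:R `^ (p + 1) * a0).
  have -> : 2 * (rho ^+ k * A) = 4 * ((2 ^+ k * B) `^ (p + 1))^-1 * a0.
    rewrite powRM ?exprn_ge0 ?(ltW B0) // -(@powR_mulrn _ 2 k) // -powRrM [k%:R * _]mulrC.
    rewrite powRrM powR_mulrn ?powR_ge0 // invfM -exprVn -/rho /A.
    by move: (_ ^-1) (rho ^+ k) => b r; ring.
  rewrite [leRHS]mulrA ler_wpM2r // -[leRHS]mulrA ler_pM2l //.
  rewrite div1r ler_pdivlMr // mulrC ler_pdivrMr ?powR_gt0 //.
  (* The factor [12 * (p + 1) * kappa] in the logarithm of the first stage length matches the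
     horizon bound, with [r = p + 1] and [c = 7 / 3]. *)
  have -> : 2 ^+ k * B = 12 * 2 ^+ k * ((p + 1) * kappa) by rewrite /B; ring.
  apply: (powR_horizon_le (sk := sk)) => //; rewrite ?mulr_ge0 ?exprn_ge0 ?(ltW sk0) //.
  exact: sqrt_kappa_le mu0 muL.
have noise_le : 17 * (s / 2 ^+ k.+2) <= 111 * ((p + 1) * sigma ^+ 2 / (n%:R * mu)).
  have -> : s / 2 ^+ k.+2 = sigma ^+ 2 / mu * (2 ^+ k.+2 * sk)^-1.
    by rewrite /s !invfM; ring.
  have -> : (p + 1) * sigma ^+ 2 / (n%:R * mu) = sigma ^+ 2 / mu * ((p + 1) / n%:R).
    by rewrite invfM; ring.
  have tau0 : 0 <= sigma ^+ 2 / mu by apply: divr_ge0; [exact: sqr_ge0|exact: ltW].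
  have D0 : 0 < 2 ^+ k * sk by rewrite mulr_gt0 ?exprn_gt0.
  have D'0 : 0 < 2 ^+ k.+2 * sk by rewrite mulr_gt0 ?exprn_gt0.
  rewrite mulrCA [leRHS]mulrCA; apply: (ler_wpM2l tau0).
  rewrite ler_pdivrMr //.
  have -> : 111 * ((p + 1) / n%:R) * (2 ^+ k.+2 * sk) =
      444 * ((p + 1) * (2 ^+ k * sk)) / n%:R by rewrite !exprS; ring.
  rewrite ler_pdivlMr //.
  (* By [1 <= p], [17 * 12 * (p + 1 + 7 / 3)] is at most [442 * (p + 1)], which is below
     [4 * 111 * (p + 1)]. *)
  have : 0 <= (2 ^+ k * sk) * (p - 1) by rewrite mulr_ge0 ?(ltW D0) // subr_ge0.
  have {}n_horizon : n%:R <= 12 * ((2 ^+ k * sk) * (p + 1 + 7 / 3)).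
    by rewrite mulrA [12 * _]mulrA.
  by move: (2 ^+ k * sk) D0 n_horizon => D D0 n_horizon; lra.
have c0 : 0 <= 4 * expR (7 / 3) :> R by rewrite mulr_ge0 ?expR_ge0.
apply: le_trans gap_le _; rewrite [leRHS]mulrDr; apply: lerD.
  apply: le_trans bias_le _; apply: ler_wpM2r; last by rewrite lerDr.
  by rewrite mulr_ge0 // divr_ge0 // ltW.
apply: le_trans noise_le _; apply: ler_wpM2r; last by rewrite lerDl.
by rewrite divr_ge0 ?mulr_ge0 ?sqr_ge0 // ltW.
Qed.
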